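(* Let $n,m$ be positive integers. Let $\mathbb{Z}\subset\mathbb{R}^n$ be closed and convex, let $H\in\mathbb{R}^{n\times n}$ be symmetric, let $G\in\mathbb{R}^{m\times n}$ have full row rank, let $h\in\mathbb{R}^n$ and $g\in\mathbb{R}^m$, and let $\lambda,\sigma\geq 0$ be real numbers such that $0\preceq H\preceq\lambda I$ and $G^\top G\preceq\sigma I$. Suppose $z^\star\in\mathbb{R}^n$ and $w^\star\in\mathbb{R}^m$ satisfy $$Gz^\star=g,\qquad z^\star\in\mathbb{Z},\qquad \langle Hz^\star+h+G^\top w^\star,\, z-z^\star\rangle\geq 0\quad\text{for all } z\in\mathbb{Z}.$$ Let $\beta>0$ and $\alpha=\frac{1}{\beta\sigma+\lambda}$, let $z^1\in\mathbb{R}^n$ and $w^1\in\mathbb{R}^m$ be arbitrary, and let the sequence $\{v^k,z^k,w^k\}_{k\geq 1}$ be generated, for all $k\geq 1$, by $$v^k=w^k+\beta(Gz^k-g),$$ $$z^{k+1}=\pi_{\mathbb{Z}}\big[z^k-\alpha(Hz^k+h+G^\top v^k)\big],$$ $$w^{k+1}=w^k+\beta(Gz^{k+1}-g).$$ Let $$V^1=\frac{1}{2\alpha}\|z^1-z^\star\|_2^2+\frac{1}{2\beta}\|w^1-w^\star\|_2^2,$$ and for $k\geq 1$ let $\hat z^k=\frac1k\sum_{j=1}^k z^j$ and $\tilde z^k=\frac1k\sum_{j=1}^k z^{j+1}$. Then for all $k\geq 1$, $$\frac12\|G\hat z^k-g\|_2^2\leq\frac{1}{\beta k}V^1,\qquad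 \frac12\|\tilde z^k-z^\star\|_H^2\leq\frac1k V^1.$$
   Context: Superscripts $k,j$ on vectors are iteration indices, not powers. $\langle z,y\rangle=z^\top y$, $\|z\|_2=\sqrt{z^\top z}$, and $\|z\|_H=\sqrt{z^\top Hz}$. For symmetric matrices, $H\preceq P$ means that $P-H$ is positive semi-definite; $I$ is the identity matrix. For a closed convex (nonempty) set $\mathbb{Z}\subset\mathbb{R}^n$, $\pi_{\mathbb{Z}}[z]=\operatorname{argmin}_{z'\in\mathbb{Z}}\|z'-z\|_2$ is the Euclidean projection onto $\mathbb{Z}$. The underlying optimization problem is to minimize $\frac12 z^\top Hz+h^\top z$ subject to $Gz=g$, $z\in\mathbb{Z}$; the conditions on $(z^\star,w^\star)$ are its Karush–Kuhn–Tucker conditions. *)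

(* Defs.v *)
From HB Require Import structures.
From mathcomp Require Import all_boot all_order all_algebra.
From mathcomp Require Import all_classical all_reals all_analysis.

Set Implicit Arguments.
Unset Strict Implicit.
Unset Printing Implicit Defensive.
Import Order.TTheory GRing.Theory Num.Theory.
Import numFieldNormedType.Exports.

Local Open Scope classical_set_scope.
Local Open Scope ring_scope.

(* Vectors of R^n are column vectors 'cV[R]_n. The library norm `|x| on them is
   the sup norm, hence the explicit Euclidean norm below; closed sets are those
   of the library topology, which is the usual topology of R^n. *)

Definition dotv (R : realType) (n : nat) (x y : 'cV[R]_n) : R :=
  (x^T *m y) 0 0.

Definition norm2 (R : realType) (n : nat) (x : 'cV[R]_n) : R :=
  Num.sqrt (dotv x x).

(* Meaningful for H positive semidefinite: Num.sqrt is 0 on negative reals. *)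
Definition normH (R : realType) (n : nat) (H : 'M[R]_n) (x : 'cV[R]_n) : R :=
  Num.sqrt (dotv x (H *m x)).

Definition psdmx (R : realType) (n : nat) (A : 'M[R]_n) : Prop :=
  A^T = A /\ forall x : 'cV[R]_n, 0 <= dotv x (A *m x).

Definition loewner_le (R : realType) (n : nat) (A B : 'M[R]_n) : Prop :=
  psdmx (B - A).

Definition argmin_dist (R : realType) (n : nat) (Z : set 'cV[R]_n)
    (x : 'cV[R]_n) : set 'cV[R]_n :=
  [set y | Z y /\ forall z, Z z -> norm2 (y - x) <= norm2 (z - x)].

(* For Z nonempty, closed and convex, argmin_dist Z x is a singleton and
   proj_on Z x is its element; the default value 0 is then irrelevant. *)
Definition proj_on (R : realType) (n : nat) (Z : set 'cV[R]_n)
    (x : 'cV[R]_n) : 'cV[R]_n :=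
  xget 0 (argmin_dist Z x).

(* Main.v *)
(* With e^k = z^k - z*, u^k = w^k - w* and L = 1 / alpha = beta sigma + lambda,
   the matrix P = L I - H - beta G^T G is positive semidefinite. The variational
   inequality of the projection, tested at z*, plus the KKT inequality, tested
   at z^{k+1}, shows that the function |e^k|_P^2 / 2 + |u^k|^2 / (2 beta)
   decreases at each step by at least |e^{k+1}|_H^2 + beta |G e^{k+1}|^2 / 2.
   Telescoping bounds the sums of these two terms, and convexity passes to the
   averages. The first sum may start at z^1 because V^1 exceeds the initial
   value of the Lyapunov function by (|e^1|_H^2 + beta |G e^1|^2) / 2. *)

Require Import Defs.
From HB Require Import structures.
From mathcomp Require Import all_boot all_order all_algebra.
From mathcomp Require Import all_classical all_reals all_analysis.
From mathcomp Require Import ring lra.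

Set Implicit Arguments.
Unset Strict Implicit.
Unset Printing Implicit Defensive.
Import Order.TTheory GRing.Theory Num.Theory.
Import numFieldNormedType.Exports.

Local Open Scope classical_set_scope.
Local Open Scope ring_scope.

(** * Bilinearity and positivity of the Euclidean inner product *)

Lemma dotvE (R : realType) (n : nat) (x y : 'cV[R]_n) :
  dotv x y = \sum_i x i 0 * y i 0.
Proof. by rewrite /dotv mxE; apply: eq_bigr => i _; rewrite mxE. Qed.

Lemma dotvC (R : realType) (n : nat) (x y : 'cV[R]_n) : dotv x y = dotv y x.
Proof. by rewrite !dotvE; apply: eq_bigr => i _; rewrite mulrC. Qed.

Lemma dotvDl (R : realType) (n : nat) (x y t : 'cV[R]_n) :
  dotv (x + y) t = dotv x t + dotv y t.
Proof. by rewrite /dotv linearD mulmxDl mxE. Qed.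

Lemma dotvNl (R : realType) (n : nat) (x t : 'cV[R]_n) :
  dotv (- x) t = - dotv x t.
Proof. by rewrite /dotv linearN mulNmx mxE. Qed.

Lemma dotvZl (R : realType) (n : nat) (a : R) (x t : 'cV[R]_n) :
  dotv (a *: x) t = a * dotv x t.
Proof. by rewrite /dotv linearZ -scalemxAl mxE. Qed.

Lemma dotvDr (R : realType) (n : nat) (x y t : 'cV[R]_n) :
  dotv t (x + y) = dotv t x + dotv t y.
Proof. by rewrite /dotv mulmxDr mxE. Qed.

Lemma dotvNr (R : realType) (n : nat) (x t : 'cV[R]_n) :
  dotv t (- x) = - dotv t x.
Proof. by rewrite /dotv mulmxN mxE. Qed.

Lemma dotvZr (R : realType) (n : nat) (a : R) (x t : 'cV[R]_n) :
  dotv t (a *: x) = a * dotv t x.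
Proof. by rewrite /dotv -scalemxAr mxE. Qed.

Definition dotv_lin := (dotvDl, dotvDr, dotvNl, dotvNr, dotvZl, dotvZr).

Lemma dotv_trmx (R : realType) (m n : nat) (A : 'M[R]_(m, n))
    (u : 'cV[R]_m) (x : 'cV[R]_n) : dotv (A^T *m u) x = dotv u (A *m x).
Proof. by rewrite /dotv trmx_mul trmxK mulmxA. Qed.

Lemma dotv_ge0 (R : realType) (n : nat) (x : 'cV[R]_n) : 0 <= dotv x x.
Proof. by rewrite dotvE sumr_ge0 // => i _; rewrite -expr2 sqr_ge0. Qed.

Lemma dotv_eq0 (R : realType) (n : nat) (x : 'cV[R]_n) :
  (dotv x x == 0) = (x == 0).
Proof.
apply/eqP/eqP => [|->]; last by rewrite /dotv mulmx0 mxE.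
rewrite dotvE => /eqP; rewrite psumr_eq0 => [/allP x0|i _]; last first.
  by rewrite -expr2 sqr_ge0.
apply/colP => i; rewrite mxE; apply/eqP.
by have := x0 i (mem_index_enum i); rewrite mulf_eq0 orbb.
Qed.

Lemma norm2_sqr (R : realType) (n : nat) (x : 'cV[R]_n) :
  norm2 x ^+ 2 = dotv x x.
Proof. by rewrite sqr_sqrtr // dotv_ge0. Qed.

Lemma psdmx_ge0 (R : realType) (n : nat) (H : 'M[R]_n) (x : 'cV[R]_n) :
  loewner_le 0 H -> 0 <= dotv x (H *m x).
Proof. by rewrite /loewner_le subr0 => -[_]. Qed.

Lemma normH_sqr (R : realType) (n : nat) (H : 'M[R]_n) (x : 'cV[R]_n) :
  loewner_le 0 H -> normH H x ^+ 2 = dotv x (H *m x).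
Proof. by move=> H0; rewrite sqr_sqrtr // psdmx_ge0. Qed.

Lemma loewner_le_scalar (R : realType) (n : nat) (A : 'M[R]_n) (a : R)
    (x : 'cV[R]_n) :
  loewner_le A a%:M -> dotv x (A *m x) <= a * dotv x x.
Proof.
move=> [_ /(_ x)].
by rewrite mulmxBl mul_scalar_mx dotvDr dotvNr dotvZr subr_ge0.
Qed.

(** * Existence and variational inequality of the projection *)

Lemma coord_le_norm2 (R : realType) (n : nat) (x : 'cV[R]_n) (i : 'I_n) :
  `|x i 0| <= norm2 x.
Proof.
rewrite -(ler_sqr (normr_ge0 _) (sqrtr_ge0 _)) norm2_sqr dotvE.
rewrite real_normK ?num_real // (bigD1 i) //= -expr2 lerDl.
by rewrite sumr_ge0 // => j _; rewrite -expr2 sqr_ge0.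
Qed.

(** Transposition keeps every entry, hence maps sup-norm balls to sup-norm balls. It carries
    closedness of [Z] over to row vectors. *)
Lemma trmx_continuous (R : realType) (m n : nat) :
  continuous (fun x : 'M[R]_(m, n) => x^T : 'M[R]_(n, m)).
Proof.
move=> x s /= /nbhs_ballP [e e0 es]; apply/nbhs_ballP; exists e => //= y [_ xy].
by apply: es; split=> // i j; rewrite !mxE; exact: xy.
Qed.

Lemma argmin_dist_nonempty (R : realType) (n : nat) (Z : set 'cV[R]_n)
    (x : 'cV[R]_n) :
  closed Z -> Z !=set0 -> argmin_dist Z x !=set0.
Proof.
move=> Zc [y0 Zy0]; pose D := norm2 (y0 - x).
(* The library's Heine-Borel theorem is for row vectors; points of Z outside
   the sup-norm box of radius D around x are farther from x than y0. *)
pose B := [set t : 'rV[R]_n |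
  forall i, `[x i 0 - D, x i 0 + D]%classic (t ord0 i)].
pose A := B `&` (fun t : 'rV[R]_n => t^T : 'cV[R]_n) @^-1` Z.
have inB y : norm2 (y - x) <= D -> B y^T.
  move=> yD i; have := le_trans (coord_le_norm2 (y - x) i) yD.
  by rewrite !mxE /= in_itv /= ler_distl.
have cA : compact A.
  apply: compact_closedI.
    apply: (@rV_compact _ _ (fun i => `[x i 0 - D, x i 0 + D]%classic)) => i.
    exact: segment_compact.
  apply: preimage_closed Zc => t _; exact: trmx_continuous.
have A0 : A !=set0 by exists y0^T; split; [exact: inB | rewrite /= trmxK].
pose f (t : 'rV[R]_n) : R := \sum_i (t ord0 i - x i 0) * (t ord0 i - x i 0).
have fE y : f y^T = dotv (y - x) (y - x).
  by rewrite dotvE; apply: eq_bigr => i _; rewrite !mxE.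
have fc : continuous f.
  apply: (continuous_big (@add_continuous R)) => i _ t.
  have ci : t' ord0 i - x i 0 @[t' --> t] --> t ord0 i - x i 0.
    by apply: cvgB; [exact: coord_continuous | exact: cvg_cst].
  exact: (cvgM ci ci).
have [c] := compact_EVT_min A0 cA (continuous_subspaceT fc).
rewrite inE => -[Bc Zc'] cmin; exists c^T; split => // y Zy.
have cmin' y' : A y'^T -> norm2 (c^T - x) <= norm2 (y' - x).
  by move=> Ay'; rewrite ler_sqrt ?dotv_ge0 // -!fE trmxK cmin // inE.
(* A point of [Z] outside the ball of radius [D] is compared with [y0], which lies in the box. *)
have [yD|/ltW yD] := leP (norm2 (y - x)) D.
  by apply: cmin'; split; [exact: inB | rewrite /= trmxK].
by apply: le_trans yD; apply: cmin'; split; [exact: inB | rewrite /= trmxK].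
Qed.

(** First-order optimality: the segment from [p] to [y] stays in [Z], so the squared distance to [x]
    cannot drop along it, which rules out a negative slope at [p]. *)
Lemma argmin_dist_vi (R : realType) (n : nat) (Z : set 'cV[R]_n)
    (x p y : 'cV[R]_n) :
  convex_set (Z : set (convex_lmodType 'cV[R]_n)) ->
  argmin_dist Z x p -> Z y -> 0 <= dotv (p - x) (y - p).
Proof.
move=> Zconv [Zp pmin] Zy.
have quad (t : R) : 0 <= t <= 1 ->
    0 <= 2 * t * dotv (p - x) (y - p) + t ^+ 2 * dotv (y - p) (y - p).
  move=> /andP[t0 t1].
  (* The weights in [convex_set] are interval-typed, so [t] is packed with its bounds. *)
  have t01 : Itv.spec (@Itv.num_sem R) (Itv.Real `[0%Z, 1%Z]) t.
    by rewrite /= /Itv.num_sem /= num_real /= in_itv /= t0 t1.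
  have : Z (t *: y + (1 - t) *: p).
    have := Zconv y p (Itv.mk t01); rewrite !inE => /(_ Zy Zp); exact.
  move=> /pmin; rewrite ler_sqrt ?dotv_ge0 //.
  rewrite (_ : _ + _ - x = (p - x) + t *: (y - p)); last first.
    by apply/colP => i; rewrite !mxE; ring.
  rewrite !(dotvDl (p - x)) !(dotvDr (p - x)) !dotvZl !dotvZr.
  by rewrite (dotvC (y - p) (p - x)) => ?; lra.
have b0 := dotv_ge0 (y - p); rewrite leNgt; apply/negP => a0.
move: quad a0 b0; set a := dotv _ _; set b := dotv _ _ => quad a0 b0.
(* The quadratic is minimal at - a / b; the denominator [b - a] keeps the test point in [0, 1] and
   also covers b = 0. *)
have ba : 0 < b - a by lra.
(* At t = - a / (b - a) the quadratic bound fails. *)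
have t01 : 0 <= - a / (b - a) <= 1.
  apply/andP; split; first by apply: divr_ge0; lra.
  by rewrite ler_pdivrMr //; lra.
have := quad _ t01; rewrite (_ : _ + _ = a ^+ 2 / (b - a) ^+ 2 * (2 * a - b)).
  rewrite pmulr_rge0; first lra.
  by rewrite divr_gt0 // exprn_even_gt0 //= ?(lt_eqF a0) ?(gt_eqF ba).
by field; rewrite gt_eqF.
Qed.

Lemma proj_on_mem_vi (R : realType) (n : nat) (Z : set 'cV[R]_n)
    (x y : 'cV[R]_n) :
  closed Z -> convex_set (Z : set (convex_lmodType 'cV[R]_n)) -> Z y ->
  Z (proj_on Z x) /\ 0 <= dotv (proj_on Z x - x) (y - proj_on Z x).
Proof.
move=> Zc Zconv Zy.
have pP : argmin_dist Z x (proj_on Z x).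
  (* The point [y] makes [Z] nonempty, so [xget] returns a minimizer and not its default. *)
  by apply: xgetPex; apply: argmin_dist_nonempty => //; exists y.
by split; [case: pP | exact: argmin_dist_vi pP Zy].
Qed.

(* Cauchy-Schwarz, from the nonnegativity of the form at N x_i - S. *)
Lemma dotv_sum_le (R : realType) (n : nat) (A : 'M[R]_n) (I : Type)
    (r : seq I) (F : I -> 'cV[R]_n) :
  psdmx A ->
  dotv (\sum_(i <- r) F i) (A *m \sum_(i <- r) F i) <=
    (size r)%:R * \sum_(i <- r) dotv (F i) (A *m F i).
Proof.
move=> [Asym A0]; set S := \sum_(i <- r) F i; set N : R := (size r)%:R.
have AC x y : dotv x (A *m y) = dotv y (A *m x).
  by rewrite -dotv_trmx Asym dotvC.
have lin t : \sum_(i <- r) dotv (F i) t = dotv S t.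
  rewrite /S; elim/big_rec2: _ => [|i s s' _ ->]; last by rewrite dotvDl.
  by rewrite /dotv trmx0 mul0mx mxE.
have [r0|r0] := eqVneq (size r) 0%N.
  move/size0nil: (r0) => rnil; rewrite /S /N rnil !big_nil mulr0.
  by rewrite mulmx0 /dotv mulmx0 mxE.
have N0 : 0 < N by rewrite ltr0n lt0n.
have : 0 <= \sum_(i <- r) dotv (N *: F i - S) (A *m (N *: F i - S)).
  by rewrite sumr_ge0.
rewrite (eq_bigr (fun i => N ^+ 2 * dotv (F i) (A *m F i)
    - 2 * N * dotv (F i) (A *m S) + dotv S (A *m S))); last first.
  move=> i _; rewrite mulmxBr -scalemxAr !dotv_lin (AC S (F i)); ring.
(* With q the form of [A], the sum collapses to N (N sum_i q(F i) - q(S)), and N > 0 cancels. *)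
rewrite big_split sumrB -!mulr_sumr lin /= big_const_seq count_predT.
rewrite iter_addr_0 -mulr_natr -/N => ge0.
by rewrite -(ler_pM2l N0); lra.
Qed.

(** * The Lyapunov function and its decrease *)

Definition lyapunov (R : realType) (n m : nat) (H : 'M[R]_n) (G : 'M[R]_(m, n))
    (L beta : R) (x : 'cV[R]_n) (u : 'cV[R]_m) : R :=
  1 / 2 * (L * dotv x x - dotv x (H *m x) - beta * dotv (G *m x) (G *m x))
  + 1 / (2 * beta) * dotv u u.

Lemma lyapunov_step (R : realType) (n m : nat) (H : 'M[R]_n)
    (G : 'M[R]_(m, n)) (L beta : R) (x y : 'cV[R]_n) (u : 'cV[R]_m) :
  H^T = H -> 0 < beta ->
  (forall d : 'cV[R]_n,
    dotv d (H *m d) + beta * dotv (G *m d) (G *m d) <= L * dotv d d) ->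
  L * dotv (y - x) y + dotv (H *m x) y
    + dotv (u + beta *: (G *m x)) (G *m y) <= 0 ->
  lyapunov H G L beta y (u + beta *: (G *m y))
    + dotv y (H *m y) + beta / 2 * dotv (G *m y) (G *m y)
  <= lyapunov H G L beta x u.
Proof.
move=> Hsym b0 /(_ (y - x)); rewrite /lyapunov !mulmxBr !dotv_lin.
have Hyx : dotv y (H *m x) = dotv x (H *m y).
  by rewrite -dotv_trmx Hsym dotvC.
rewrite (dotvC (H *m x) y) Hyx (dotvC y x).
rewrite (dotvC (G *m y) (G *m x)) (dotvC (G *m y) u).
set A := dotv u u; set B := dotv u (G *m y); set C := dotv (G *m y) (G *m y).
have -> : 1 / (2 * beta) * (A + beta * B + (beta * B + beta * (beta * C)))
    = 1 / (2 * beta) * A + B + beta / 2 * C.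
  by field; rewrite gt_eqF.
by move=> *; lra.
Qed.

(** If sigma were 0, every column of [G] would have norm 0, so [G] would vanish, against its full
    row rank m > 0. *)
Lemma inv_stepsize_gt0 (R : realType) (n m : nat) (G : 'M[R]_(m, n))
    (lambda sigma beta : R) :
  (0 < m)%N -> row_free G -> loewner_le (G^T *m G) sigma%:M ->
  0 <= lambda -> 0 <= sigma -> 0 < beta -> 0 < beta * sigma + lambda.
Proof.
move=> m0 Gfree GG l0 s0 b0; suff sp : 0 < sigma by rewrite ltr_pwDl ?mulr_gt0.
rewrite lt_def s0 andbT; apply/eqP => sE; move: Gfree.
suff -> : G = 0 by rewrite /row_free mxrank0 eq_sym gtn_eqF.
apply/matrixP => i j.
have /eqP : G *m delta_mx j (0 : 'I_1) == 0.
  have := loewner_le_scalar (delta_mx j 0) GG.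
  rewrite -mulmxA dotvC dotv_trmx sE mul0r -dotv_eq0 => G0.
  by rewrite eq_le G0 dotv_ge0.
by rewrite -colE => /colP /(_ i); rewrite !mxE.
Qed.

Theorem theorem1 (R : realType) (n m : nat) (hn : (0 < n)%N) (hm : (0 < m)%N)
  (Z : set 'cV[R]_n) (Zclosed : closed Z)
  (Zconvex : convex_set (Z : set (convex_lmodType 'cV[R]_n)))
  (H : 'M[R]_n) (Hsym : H^T = H)
  (G : 'M[R]_(m, n)) (Grank : row_free G)
  (h : 'cV[R]_n) (g : 'cV[R]_m)
  (lambda sigma : R) (lambda_ge0 : 0 <= lambda) (sigma_ge0 : 0 <= sigma)
  (H_ge0 : loewner_le 0 H) (H_le : loewner_le H lambda%:M)
  (GG_le : loewner_le (G^T *m G) sigma%:M)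
  (zs : 'cV[R]_n) (ws : 'cV[R]_m)
  (kkt_eq : G *m zs = g) (kkt_mem : Z zs)
  (kkt_vi : forall x : 'cV[R]_n, Z x ->
     0 <= dotv (H *m zs + h + G^T *m ws) (x - zs))
  (beta alpha : R) (beta_gt0 : 0 < beta)
  (alphaE : alpha = 1 / (beta * sigma + lambda))
  (v w : nat -> 'cV[R]_m) (z : nat -> 'cV[R]_n)
  (vE : forall k : nat, (1 <= k)%N -> v k = w k + beta *: (G *m z k - g))
  (zE : forall k : nat, (1 <= k)%N ->
     z k.+1 = proj_on Z (z k - alpha *: (H *m z k + h + G^T *m v k)))
  (wE : forall k : nat, (1 <= k)%N ->
     w k.+1 = w k + beta *: (G *m z k.+1 - g))
  (V1 : R)
  (V1E : V1 = 1 / (2 * alpha) * norm2 (z 1%N - zs) ^+ 2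
            + 1 / (2 * beta) * norm2 (w 1%N - ws) ^+ 2)
  (zhat ztilde : nat -> 'cV[R]_n)
  (zhatE : forall k : nat, (1 <= k)%N ->
     zhat k = (1 / k%:R) *: \sum_(1 <= j < k.+1) z j)
  (ztildeE : forall k : nat, (1 <= k)%N ->
     ztilde k = (1 / k%:R) *: \sum_(1 <= j < k.+1) z j.+1) :
  forall k : nat, (1 <= k)%N ->
    1 / 2 * norm2 (G *m zhat k - g) ^+ 2 <= 1 / (beta * k%:R) * V1 /\
    1 / 2 * normH H (ztilde k - zs) ^+ 2 <= 1 / k%:R * V1.
Proof.
set L := beta * sigma + lambda in alphaE.
have L0 : 0 < L by apply: inv_stepsize_gt0 GG_le _ _ _.
have a0 : 0 < alpha by rewrite alphaE divr_gt0.
have La : L * alpha = 1 by rewrite alphaE mul1r divff ?gt_eqF.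
(* This is the positivity of P: the bound on [H] plus beta times the bound on G^T G. *)
have dom (d : 'cV[R]_n) :
    dotv d (H *m d) + beta * dotv (G *m d) (G *m d) <= L * dotv d d.
  have h1 := loewner_le_scalar d H_le.
  have := loewner_le_scalar d GG_le; rewrite -mulmxA dotvC dotv_trmx => h2.
  by rewrite /L mulrDl addrC -mulrA lerD ?ler_pM2l.
pose e k := z k - zs; pose u k := w k - ws.
have Ge k : G *m z k - g = G *m e k by rewrite -kkt_eq -mulmxBr.
have uS k : (1 <= k)%N -> u k.+1 = u k + beta *: (G *m e k.+1).
  by move=> k1; rewrite /u wE // Ge addrAC.
have step k : (1 <= k)%N ->
    lyapunov H G L beta (e k.+1) (u k.+1)
      + dotv (e k.+1) (H *m e k.+1)
      + beta / 2 * dotv (G *m e k.+1) (G *m e k.+1)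
    <= lyapunov H G L beta (e k) (u k).
  move=> k1; rewrite uS //; apply: lyapunov_step => //.
  have [] := proj_on_mem_vi (z k - alpha *: (H *m z k + h + G^T *m v k))
    Zclosed Zconvex kkt_mem.
  rewrite -zE // => /kkt_vi opt proj.
  (* Multiplying by L = 1 / alpha clears the step size. *)
  have {proj} : 0 <= L * dotv (z k.+1 - z k) (zs - z k.+1)
      + dotv (H *m z k + h + G^T *m v k) (zs - z k.+1).
    move: proj; rewrite -(pmulr_rge0 _ L0) (_ : _ - (_ - alpha *: _)
      = z k.+1 - z k + alpha *: (H *m z k + h + G^T *m v k)); last first.
      by rewrite opprB addrCA addrC.
    rewrite dotvDl dotvZl.
    by rewrite mulrDr (mulrA L alpha) La mul1r.
  have -> : z k.+1 - z k = e k.+1 - e k by rewrite /e opprB addrA subrK.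
  have zsE : zs - z k.+1 = - e k.+1 by rewrite opprB.
  rewrite -/(e k.+1) in opt; rewrite zsE.
  (* The search direction is the KKT vector plus terms linear in the errors; [opt] gives the sign of
     the KKT part paired with e^{k+1}. *)
  have -> : H *m z k + h + G^T *m v k
      = (H *m zs + h + G^T *m ws) + H *m e k
        + G^T *m (u k + beta *: (G *m e k)).
    rewrite vE // Ge -[in LHS](subrK zs (z k)) -[w k](subrK ws) -/(e k) -/(u k).
    rewrite !mulmxDr.
    by apply/colP => i; rewrite !(mxE _ _ i 0); ring.
  rewrite !dotvNr [in X in _ + X]dotvDl [in X in _ + X]dotvDl dotv_trmx.
  by move=> ?; lra.
(* Telescoping; the sums cover the errors e^2, ..., e^k. *)
have sum k : (1 <= k)%N ->
    lyapunov H G L beta (e k) (u k)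
      + \sum_(1 <= j < k) dotv (e j.+1) (H *m e j.+1)
      + beta / 2 * \sum_(1 <= j < k) dotv (G *m e j.+1) (G *m e j.+1)
    <= lyapunov H G L beta (e 1%N) (u 1%N).
  elim: k => // -[_ _|k IH _]; first by rewrite !big_geq // mulr0 !addr0.
  rewrite !(@big_nat_recr _ _ _ k.+1) //= mulrDr.
  by have := IH isT; have := step k.+1 isT => ? ?; lra.
have lyap_ge0 x t : 0 <= lyapunov H G L beta x t.
  have dx := dom x; have tt : 0 <= 1 / (2 * beta) * dotv t t.
    by apply: mulr_ge0 (dotv_ge0 t); apply: divr_ge0; lra.
  by rewrite /lyapunov; lra.
have V1L : V1 = lyapunov H G L beta (e 1%N) (u 1%N)
    + dotv (e 1%N) (H *m e 1%N) / 2
    + beta / 2 * dotv (G *m e 1%N) (G *m e 1%N).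
  rewrite V1E !norm2_sqr -/(e 1%N) -/(u 1%N) /lyapunov.
  have -> : 1 / (2 * alpha) = L / 2 by rewrite alphaE; field; rewrite gt_eqF.
  by lra.
have avg (f : nat -> 'cV[R]_n) k : (1 <= k)%N ->
    (1 / k%:R) *: \sum_(1 <= j < k.+1) f j - zs
    = (1 / k%:R) *: \sum_(1 <= j < k.+1) (f j - zs).
  move=> k1; rewrite sumrB scalerBr; congr (_ - _).
  rewrite sumr_const_nat subSS subn0 -[zs *+ k]scaler_nat scalerA.
  by rewrite mul1r mulVf ?scale1r // pnatr_eq0 -lt0n.
(* Convexity of the quadratic form: [dotv_sum_le] scaled by 1 / k^2. *)
have jensen (A : 'M[R]_n) (f : nat -> 'cV[R]_n) k : psdmx A -> (1 <= k)%N ->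
    dotv ((1 / k%:R) *: \sum_(1 <= j < k.+1) f j)
      (A *m ((1 / k%:R) *: \sum_(1 <= j < k.+1) f j))
    <= 1 / k%:R * \sum_(1 <= j < k.+1) dotv (f j) (A *m f j).
  move=> A0 k1; rewrite -scalemxAr dotvZl dotvZr mulrA.
  have := dotv_sum_le (index_iota 1 k.+1) f A0; rewrite size_iota subSS subn0.
  have k0 : 0 < k%:R :> R by rewrite ltr0n.
  move=> le_sum; have -> : 1 / k%:R * \sum_(1 <= j < k.+1) dotv (f j) (A *m f j)
      = 1 / k%:R * (1 / k%:R) *
        (k%:R * \sum_(1 <= j < k.+1) dotv (f j) (A *m f j)).
    by field; rewrite gt_eqF.
  by rewrite ler_pM2l // mulr_gt0 ?divr_gt0.
have GG0 : psdmx (G^T *m G).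
  split=> [|x]; first by rewrite trmx_mul trmxK.
  by rewrite -mulmxA dotvC dotv_trmx dotv_ge0.
have H0 : psdmx H by move: H_ge0; rewrite /loewner_le subr0.
move=> k k1; have k0 : 0 < k%:R :> R by rewrite ltr0n.
have Hsum_ge0 i : 0 <= \sum_(1 <= j < i) dotv (e j.+1) (H *m e j.+1).
  by rewrite sumr_ge0 // => j _; exact: psdmx_ge0.
have b2_ge0 : 0 <= beta / 2 by lra.
have Gsum_ge0 i : 0 <= beta / 2 *
    \sum_(1 <= j < i) dotv (G *m e j.+1) (G *m e j.+1).
  by rewrite mulr_ge0 // sumr_ge0 // => j _; exact: dotv_ge0.
have e1H := psdmx_ge0 (e 1%N) H_ge0.
have e1G : 0 <= beta / 2 * dotv (G *m e 1%N) (G *m e 1%N).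
  by rewrite mulr_ge0 ?dotv_ge0.
have Gbound : beta / 2 * \sum_(1 <= j < k.+1) dotv (G *m e j) (G *m e j) <= V1.
  (* The term j = 1 is paid by the surplus of V^1 in [V1L], the terms 2, ..., k by [sum k]. *)
  rewrite big_nat_recl // mulrDr V1L.
  by have := sum k k1; have := lyap_ge0 (e k) (u k); have := Hsum_ge0 k; lra.
have Hbound : \sum_(1 <= j < k.+1) dotv (e j.+1) (H *m e j.+1) <= V1.
  (* The errors are now e^2, ..., e^{k+1}, exactly those in [sum k.+1]. *)
  rewrite V1L; have := sum k.+1 isT; have := lyap_ge0 (e k.+1) (u k.+1).
  by have := Gsum_ge0 k.+1; lra.
split.
  rewrite zhatE // norm2_sqr -kkt_eq -mulmxBr avg //.
  (* The form of G^T G at x is |G x|^2. *)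
  have := jensen _ e k GG0 k1.
  rewrite -mulmxA dotvC dotv_trmx => le_avg.
  rewrite (eq_bigr (fun j => dotv (G *m e j) (G *m e j))) in le_avg; last first.
    by move=> j _; rewrite -mulmxA dotvC dotv_trmx.
  apply: (le_trans (ler_wpM2l _ le_avg)); first by lra.
  have -> : 1 / (beta * k%:R) = 1 / k%:R / beta by field; rewrite !gt_eqF.
  rewrite mulrCA -[leRHS]mulrA ler_pM2l ?divr_gt0 // mul1r.
  by rewrite -(ler_pM2l beta_gt0) mulVKf ?gt_eqF // mulrA.
rewrite normH_sqr // ztildeE // avg //.
apply: (le_trans (ler_wpM2l _ (jensen _ (fun j => e j.+1) k H0 k1))).
  by lra.
rewrite mulrCA ler_pM2l ?divr_gt0 //.
(* [Hbound] controls the whole sum, and half of a nonnegative sum is at most the sum. *)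
by have := Hsum_ge0 k.+1; lra.
Qed.
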